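(* Let $p=2$, let $u$ be a strictly positive harmonic function and $g:X\to(0,\infty)$. Then, for an intrinsic metric $\rho$ for $b_u=b\,(u\otimes u)$ over $(X,m|g|u^2)$, i.e. a pseudo-metric $\rho$ on $X$ with $$\frac1{m(x)|g(x)|}\sum_{y\in X}\frac{u(y)}{u(x)}b(x,y)\rho(x,y)^2\le1,\quad x\in X,$$ we have $$\frac1{h(b_u,m|g|u^2)}\le\|g\|_{\mathcal H}\le\frac{2}{h(b_u\rho,m|g|u^2)^2}.$$
   Context: Setting: $X$ is an infinite countable set, $m:X\to(0,\infty)$ is a measure of full support. Functions $\mu:X\to(0,\infty)$ are extended to measures by $\mu(A)=\sum_{x\in A}\mu(x)$. $C_c(X)$ is the set of finitely supported real functions on $X$, and $W\Subset X$ means $W$ is a finite subset of $X$. $b:X\times X\to[0,\infty)$ is a connected graph over $(X,m)$: symmetric, zero diagonal, $\sum_{y}b(x,y)<\infty$ for all $x$, and any two vertices are joined by a finite path along which $b>0$. $c:X\to\mathbb{R}$ is an arbitrary potential such that $Q(\varphi)=Q_{2,b,c}(\varphi)=\frac12\sum_{x,y}b(x,y)(\varphi(x)-\varphi(y))^2+\sum_x c(x)\varphi(x)^2\ge0$ for all $\varphi\in C_c(X)$. A function $u:X\to\mathbb{R}$ with $\sum_y b(x,y)|u(x)-u(y)|<\infty$ for all $x$ is harmonic if $\frac1{m(x)}\sum_y b(x,y)(u(x)-u(y))+\frac{c(x)}{m(x)}u(x)=0$ for all $x\in X$. Put $b_u(x,y)=b(x,y)u(x)u(y)$ and $$\|g\|_{\mathcal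 H}=\sup_{\varphi\in C_c(X),\,Q(\varphi)\ne0}\frac{\sum_X m|g|\varphi^2}{Q(\varphi)}\in[0,\infty].$$ Cheeger constant: for a symmetric weight $a:X\times X\to[0,\infty)$ and $\mu:X\to(0,\infty)$, $h(a,\mu)=\inf_{\emptyset\ne W\Subset X}\frac{a(\partial W)}{\mu(W)}$, where $\partial W=W\times(X\setminus W)$ and $a(\partial W)=\sum_{(x,y)\in\partial W}a(x,y)$. Here $b_u\rho$ is the weight $(x,y)\mapsto b_u(x,y)\rho(x,y)$. Quotients are infinite if the denominator is zero. *)

(* Defs.v *)
From mathcomp Require Import all_boot all_order all_algebra.
From mathcomp Require Import boolp classical_sets functions cardinality fsbigop.
From mathcomp Require Import reals constructive_ereal ereal numfun esum.

Set Implicit Arguments.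
Unset Strict Implicit.
Unset Printing Implicit Defensive.

Import Order.TTheory GRing.Theory Num.Theory.

Local Open Scope classical_set_scope.
Local Open Scope ring_scope.

Section Graphs.
Variables (R : realType) (X : countType).
Implicit Types (b a rho : X -> X -> R) (m mu c u g phi : X -> R) (W : set X).

(* [\esum] is only meaningful for nonnegative families; the unordered sum of
   an absolutely summable real family is the difference of the sums of its
   positive and negative parts. *)
Definition abs_sum (f : X -> R) : \bar R :=
  ((\esum_(x in [set: X]) (EFin \o f)^\+ x)
   - (\esum_(x in [set: X]) (EFin \o f)^\- x))%E.

Record graph b : Prop := Graph {
  graph_ge0 : forall x y, 0 <= b x y;
  graph_sym : forall x y, b x y = b y x;
  graph_diag : forall x, b x x = 0;
  graph_summable : forall x, ((\esum_(y in [set: X]) (b x y)%:E) < +oo)%E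
}.

Definition connected_graph b : Prop :=
  graph b /\
  forall x y, exists s : seq X, path (fun v w => 0 < b v w) x s /\ last x s = y.

Definition finitely_supported phi : Prop := finite_set [set x | phi x != 0].

(* For finitely supported [phi] the first sum is finite when [b] is a graph,
   and the second, over the support of [c * phi^2], is a finite sum. *)
Definition quad_form b c phi : \bar R :=
  ((2^-1)%:E *
     (\esum_(z in [set: X * X]) (b z.1 z.2 * (phi z.1 - phi z.2) ^+ 2)%:E)
   + (\sum_(x \in [set: X]) c x * phi x ^+ 2)%:E)%E.

Definition in_formal_domain b u : Prop :=
  forall x, ((\esum_(y in [set: X]) (b x y * `|u x - u y|)%:E) < +oo)%E.

Definition harmonic b c m u : Prop :=
  in_formal_domain b u /\
  forall x, (((m x)^-1)%:E * abs_sum (fun y => (b x y * (u x - u y))%R)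
             + (c x / m x * u x)%:E = 0)%E.

Definition hardy_norm b c m g : \bar R :=
  ereal_sup [set ((\esum_(x in [set: X]) (m x * `|g x| * phi x ^+ 2)%:E)
                    / quad_form b c phi)%E
            | phi in [set phi | finitely_supported phi
                                /\ quad_form b c phi <> 0%E]].

Definition edge_boundary W : set (X * X) := W `*` ~` W.

Definition cheeger a mu : \bar R :=
  ereal_inf [set ((\esum_(z in edge_boundary W) (a z.1 z.2)%:E)
                    / (\esum_(x in W) (mu x)%:E))%E
            | W in [set W | W !=set0 /\ finite_set W]].

Record pseudo_metric rho : Prop := PseudoMetric {
  pseudo_metric_ge0 : forall x y, 0 <= rho x y;
  pseudo_metric_diag : forall x, rho x x = 0;
  pseudo_metric_sym : forall x y, rho x y = rho y x;
  pseudo_metric_triangle : forall x y z, rho x z <= rho x y + rho y z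
}.

End Graphs.

(* Main.v *)
(* Writing phi = u f, harmonicity of u turns Q(phi) into the potential-free
   energy 1/2 sum b_u (f x - f y)^2 (ground state transform).  For f the
   indicator of a finite W this is b_u(dW), which gives the lower bound.  For
   the upper bound, with M = sum m|g| phi^2, the coarea formula for f^2 gives
   h M <= 1/2 sum b_u rho |f x^2 - f y^2|, and AM-GM together with
   sum_y b_u rho^2 <= m|g|u^2 bounds 2 h times the right-hand side by
   2 Q + h^2 M; hence h^2 M <= 2 Q. *)

Require Import Defs.
From mathcomp Require Import all_boot all_order all_algebra.
From mathcomp Require Import boolp classical_sets functions cardinality fsbigop.
From mathcomp Require Import reals constructive_ereal ereal numfun esum.
From mathcomp Require Import ring lra.
Import Order.TTheory GRing.Theory Num.Theory.
Local Open Scope classical_set_scope.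
Local Open Scope ring_scope.

Set Implicit Arguments.
Unset Strict Implicit.
Unset Printing Implicit Defensive.

(** * Scaling, reordering and symmetrizing unordered sums of nonnegative families *)

Lemma esumZl (R : realType) (T : choiceType) (D : set T) (r : R)
    (a : T -> \bar R) : 0 <= r -> (forall x, (0 <= a x)%E) ->
  (\esum_(x in D) (r%:E * a x) = r%:E * \esum_(x in D) a x)%E.
Proof.
move=> r0 a0.
have le (k : R) (f : T -> \bar R) : 0 <= k -> (forall x, (0 <= f x)%E) ->
    (\esum_(x in D) (k%:E * f x) <= k%:E * \esum_(x in D) f x)%E.
  move=> k0 f0; apply: ge_ereal_sup => _ [A /= fA <-].
  rewrite -ge0_mule_fsumr//; apply: lee_wpmul2l; first by rewrite lee_fin.
  by apply: esum_ge; exists A.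
have [->|rN0] := eqVneq r 0.
  by rewrite mul0e esum1// => x _; rewrite mul0e.
have rgt0 : 0 < r by rewrite lt_neqAle eq_sym rN0.
(* The converse inequality is [le] again, with factor [r^-1] and the family [r * a]. *)
apply/eqP; rewrite eq_le le//= -lee_pdivlMl//.
rewrite -[in leLHS](eq_esum (a := fun x => (r^-1%:E * (r%:E * a x))%E)).
  by apply: le => [|x]; rewrite ?invr_ge0// mule_ge0// lee_fin.
by move=> x _; rewrite muleA -EFinM mulVf// mul1e.
Qed.

Lemma esum_pair (R : realType) (T1 T2 : choiceType) (a : T1 -> T2 -> \bar R) :
  (forall x y, (0 <= a x y)%E) ->
  (\esum_(z in [set: T1 * T2]) a z.1 z.2
   = \esum_(x in [set: T1]) \esum_(y in [set: T2]) a x y)%E.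
Proof.
move=> a0; rewrite (esum_esum (J := fun=> [set: T2]))//; congr esum.
by apply/seteqP; split.
Qed.

Lemma esum_swap (R : realType) (T : choiceType) (a : T -> T -> \bar R) :
  (\esum_(z in [set: T * T]) a z.1 z.2
   = \esum_(z in [set: T * T]) a z.2 z.1)%E.
Proof.
rewrite (@reindex_esum R _ _ setT setT (fun z : T * T => (z.2, z.1)))//.
split=> // [[x y] [x' y'] _ _ [-> ->]//|[x y] _].
by exists (y, x).
Qed.

(** Swapping the coordinates preserves the symmetric weight, so both halves have the same sum. This
    passes between one-sided quantities (positive parts, edges leaving a set) and their symmetric
    versions. *)
Lemma esum_symmetrize (R : realType) (T : choiceType) (w G : T -> T -> R) :
  (forall x y, 0 <= w x y) -> (forall x y, w x y = w y x) ->
  (forall x y, 0 <= G x y) ->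
  (\esum_(z in [set: T * T]) (w z.1 z.2 * (G z.1 z.2 + G z.2 z.1))%:E
   = 2%:E * \esum_(z in [set: T * T]) (w z.1 z.2 * G z.1 z.2)%:E)%E.
Proof.
move=> w0 wC G0.
under eq_esum do rewrite mulrDr EFinD.
rewrite esumD; try by move=> z _; rewrite lee_fin mulr_ge0.
rewrite [X in (_ + X)%E](_ : _ =
    \esum_(z in [set: T * T]) (w z.1 z.2 * G z.1 z.2)%:E)%E; last first.
  rewrite (esum_swap (fun x y => (w x y * G x y)%:E)).
  by apply: eq_esum => z _; rewrite wC.
by rewrite -mule2n mule_natl.
Qed.

(** Each vertex occurs once as a first and once as a second endpoint, and its value is counted with
    its weighted degree. *)
Lemma esum_vertex (R : realType) (T : choiceType) (w : T -> T -> R)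
    (F : T -> R) :
  (forall x y, 0 <= w x y) -> (forall x y, w x y = w y x) ->
  (forall x, 0 <= F x) ->
  (\esum_(z in [set: T * T]) (w z.1 z.2 * (F z.1 + F z.2))%:E
   = 2%:E * \esum_(x in [set: T])
       ((F x)%:E * \esum_(y in [set: T]) (w x y)%:E))%E.
Proof.
move=> w0 wC F0; rewrite (@esum_symmetrize _ _ w (fun x _ => F x))//.
rewrite (@esum_pair _ _ _ (fun x y => (w x y * F x)%:E)); last first.
  by move=> x y; rewrite lee_fin mulr_ge0.
congr (_ * _)%E; apply: eq_esum => x _.
rewrite -esumZl//; last by move=> y; rewrite lee_fin.
by apply: eq_esum => y _; rewrite -EFinM mulrC.
Qed.

Lemma esum_finite_support (R : realType) (T : choiceType) (D : set T)
    (F : T -> R) :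
  finite_set D -> (forall x, 0 <= F x) -> (forall x, ~ D x -> F x = 0) ->
  (\esum_(x in [set: T]) (F x)%:E = (\sum_(x \in D) F x)%:E)%E.
Proof.
move=> fD F0 FD; rewrite -fsumEFin// -esum_fset//; last first.
  by move=> x _; rewrite lee_fin.
rewrite [RHS]esum_mkcond; apply: eq_esum => x _.
by case: ifPn => //; rewrite notin_setE => /FD ->.
Qed.

Lemma seq_min (R : realType) (T : eqType) (F : T -> R) (s : seq T) :
  s != [::] -> exists2 x0, x0 \in s & {in s, forall x, F x0 <= F x}.
Proof.
elim: s => // x s IH _; case: (eqVneq s [::]) => [->|/IH[y ys ymin]].
  by exists x; rewrite ?mem_head// => y; rewrite inE => /eqP ->.
have [xy|yx] := leP (F x) (F y).
  exists x; first exact: mem_head.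
  move=> z; rewrite inE => /predU1P[->//|zs].
  exact: le_trans xy (ymin z zs).
exists y; first by rewrite inE ys orbT.
by move=> z; rewrite inE => /predU1P[->|/ymin//]; exact: ltW.
Qed.

(** * Cheeger constants and the coarea inequality *)

Section Cheeger.
Variables (R : realType) (X : countType).
Implicit Types (a : X -> X -> R) (mu F : X -> R) (W : set X).

Lemma cheeger_ge0 a mu : (forall x y, 0 <= a x y) -> (forall x, 0 < mu x) ->
  (0 <= cheeger a mu)%E.
Proof.
move=> a0 mu0; apply: le_ereal_inf_tmp => _ [W _ <-].
rewrite mule_ge0 ?inve_ge0//; apply: esum_ge0 => x _; rewrite lee_fin//.
exact: ltW.
Qed.

Lemma measure_finite_gt0 mu W : (forall x, 0 < mu x) -> W !=set0 ->
  finite_set W ->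
  exists2 r : R, 0 < r & (\esum_(x in W) (mu x)%:E = r%:E)%E.
Proof.
move=> mu0 [x0 Wx0] fW.
have mu0E x : (0 <= (mu x)%:E)%E by rewrite lee_fin ltW.
have E := esum_fset fW (fun x _ => mu0E x); rewrite fsumEFin// in E.
exists (\sum_(x \in W) mu x) => //; rewrite -lte_fin -E.
apply: (@lt_le_trans _ _ (mu x0)%:E); first by rewrite lte_fin.
rewrite -(@esum_set1 _ _ x0 (fun x => (mu x)%:E))//.
rewrite (esumID [set x0] W)// (_ : W `&` [set x0] = [set x0]); last first.
  by rewrite setIidr// => _ ->.
by rewrite leeDl// esum_ge0.
Qed.

(** The defining infimum with its denominator cleared, which is legitimate because [mu] of [W] is
    positive and finite. *)
Lemma cheeger_le_boundary a mu W : (forall x y, 0 <= a x y) ->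
  (forall x, 0 < mu x) -> W !=set0 -> finite_set W ->
  (cheeger a mu * (\esum_(x in W) (mu x)%:E)
   <= \esum_(z in edge_boundary W) (a z.1 z.2)%:E)%E.
Proof.
move=> a0 mu0 W0 fW; have [r r0 E] := measure_finite_gt0 mu0 W0 fW.
rewrite E -lee_pdivlMr//; apply: ereal_inf_lbound; exists W => //=.
by rewrite E inver gt_eqF.
Qed.

(* Peeling off the lowest nonzero level of [F] lowers both sides by [t] times
   the measure of the support and of its boundary: a discrete coarea formula. *)
Lemma cheeger_coarea a mu F : (forall x y, 0 <= a x y) ->
  (forall x, 0 < mu x) -> (forall x, 0 <= F x) -> finitely_supported F ->
  (cheeger a mu * (\esum_(x in [set: X]) (mu x * F x)%:E)
   <= \esum_(z in [set: X * X]) (a z.1 z.2 * Num.max 0 (F z.1 - F z.2))%:E)%E.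
Proof.
move=> a0 mu0 + /finite_seqP[s sE].
have {sE}: forall x, x \notin s -> F x = 0.
  move=> x xs; apply/eqP; apply: contraNT xs => Fx.
  by have : [set` s] x by rewrite -sE.
(* Strong induction on the length of a list carrying the support, with [F] generalized: peeling
   replaces [F] by [F'] on a shorter list. *)
elim: {s}(size s).+1 {-2}s (ltnSn (size s)) F => // n IH s sn F Fs F0.
have mu0' x : 0 <= mu x by exact: ltW.
pose p := [seq x <- s | 0 < F x].
have Fp x : x \notin p -> F x = 0.
  rewrite mem_filter negb_and -leNgt => /orP[Fx|/Fs//].
  by apply/eqP; rewrite eq_le Fx F0.
have [p0|pN0] := eqVneq p [::].
  rewrite esum1 ?mule0; last by move=> x _; rewrite Fp ?mulr0// p0.
  by apply: esum_ge0 => z _; rewrite lee_fin mulr_ge0// le_max lexx.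
have [x0 x0p x0min] := seq_min F pN0.
pose t := F x0; pose W := [set` p].
have t0 : 0 < t by move: x0p; rewrite mem_filter => /andP[].
pose F' x := F x - t * (x \in p)%:R.
have F'0 x : 0 <= F' x.
  rewrite /F'; case: (boolP (x \in p)) => [/x0min|_]; last by rewrite mulr0 subr0.
  by rewrite mulr1 subr_ge0.
have muE : (\esum_(x in [set: X]) (mu x * F x)%:E
    = t%:E * (\esum_(x in W) (mu x)%:E)
      + \esum_(x in [set: X]) (mu x * F' x)%:E)%E.
  rewrite [in RHS]esum_mkcond -esumZl ?ltW//; last first.
    by move=> x; case: ifP => // _; rewrite lee_fin.
  rewrite -esumD; last 2 first.
  - move=> x _; case: ifP => _; rewrite ?mule0//.
    by rewrite -EFinM lee_fin mulr_ge0// ltW.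
  - by move=> x _; rewrite lee_fin mulr_ge0.
  apply: eq_esum => x _; rewrite /F' mem_setE.
  by case: ifP => _; rewrite ?mule0 ?add0e -?EFinM -?EFinD; congr EFin;
    rewrite ?mulr1 ?mulr0; ring.
have aE : (\esum_(z in [set: X * X])
      (a z.1 z.2 * Num.max 0 (F z.1 - F z.2))%:E
    = t%:E * (\esum_(z in edge_boundary W) (a z.1 z.2)%:E)
      + \esum_(z in [set: X * X])
          (a z.1 z.2 * Num.max 0 (F' z.1 - F' z.2))%:E)%E.
  rewrite [in RHS]esum_mkcond -esumZl ?ltW//; last first.
    by move=> x; case: ifP => // _; rewrite lee_fin.
  rewrite -esumD; last 2 first.
  - move=> x _; case: ifP => _; rewrite ?mule0//.
    by rewrite -EFinM lee_fin mulr_ge0// ltW.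
  - by move=> x _; rewrite lee_fin mulr_ge0// le_max lexx.
  apply: eq_esum => -[x y] _ /=.
  have -> : ((x, y) \in edge_boundary W) = (x \in p) && (y \notin p).
    apply/idP/andP; rewrite inE /edge_boundary /W /=.
      by move=> [/= ? /negP].
    by move=> [? /negP].
  (* If [x] and [y] lie on the same side of the support, the difference is unchanged. From the
     support outwards it drops by exactly [t], and minimality of [t] keeps it nonnegative. In the
     reverse direction both positive parts vanish. *)
  rewrite /F'; case: (boolP (x \in p)) => xp; case: (boolP (y \in p)) => yp /=;
    rewrite ?mule0 ?add0e -?EFinM -?EFinD; congr EFin.
  - by rewrite (_ : F x - _ - _ = F x - F y)//; ring.
  - rewrite (Fp y)// !mulr0 !mulr1 !subr0 !max_r//; first by ring.
    by rewrite subr_ge0 x0min.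
  - by rewrite (Fp x)// mulr0 mulr1 subr0 !sub0r !max_l// oppr_le0// subr_ge0 x0min.
  - by rewrite !mulr0 !subr0.
have h0 := cheeger_ge0 a0 mu0.
rewrite muE aE ge0_muleDr; last 2 first.
- by apply: mule_ge0; [rewrite lee_fin ltW|apply: esum_ge0 => x _; rewrite lee_fin].
- by apply: esum_ge0 => x _; rewrite lee_fin mulr_ge0.
apply: leeD.
  rewrite muleCA lee_pmul2l//; apply: cheeger_le_boundary => //.
  - by exists x0.
  - exact: finite_seq.
(* The minimizer [x0] leaves the support of [F'], so the list becomes strictly shorter. *)
have F'E x : x \notin [seq y <- p | y != x0] -> F' x = 0.
  rewrite mem_filter negb_and negbK /F' => /orP[/eqP ->|xp].
    by rewrite x0p mulr1 subrr.
  by rewrite Fp// (negbTE xp) mulr0 subr0.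
apply: (IH [seq y <- p | y != x0]) => //.
apply: (@leq_trans (size p)); last first.
  by rewrite (leq_trans _ (sn : (size s <= n)%N))// size_filter count_size.
rewrite size_filter -(count_predC (fun y => y != x0) p) -ltn_subLR ?subnn//.
by rewrite -has_count; apply/hasP; exists x0 => //=; rewrite negbK.
Qed.

End Cheeger.

(** * Ground state transform and energy estimates *)

Section GroundState.
Variables (R : realType) (X : countType).
Implicit Types (b w rho : X -> X -> R) (mu c m u f : X -> R) (W : set X).

(** With finite degrees [V] and finite support the vertex sum is a real number, so it can be
    cancelled in extended-real identities. *)
Lemma esum_vertex_fin w (V F : X -> R) (D : set X) :
  (forall x y, 0 <= w x y) -> (forall x y, w x y = w y x) ->
  (forall x, (\esum_(y in [set: X]) (w x y)%:E)%E = (V x)%:E) ->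
  (forall x, 0 <= F x) -> finite_set D -> (forall x, ~ D x -> F x = 0) ->
  (\esum_(z in [set: X * X]) (w z.1 z.2 * (F z.1 + F z.2))%:E
   = (2 * \sum_(x \in D) F x * V x)%:E)%E.
Proof.
move=> w0 wC wV F0 fD FD; rewrite esum_vertex// EFinM; congr (_ * _)%E.
under eq_esum do rewrite wV -EFinM.
apply: esum_finite_support => // x; last by move=> /FD ->; rewrite mul0r.
by rewrite mulr_ge0// -lee_fin -wV esum_ge0// => y _; rewrite lee_fin.
Qed.

Lemma dirichlet_fin_num w f :
  (forall x y, 0 <= w x y) -> (forall x y, w x y = w y x) ->
  (forall x, (\esum_(y in [set: X]) (w x y)%:E < +oo)%E) ->
  finitely_supported f ->
  (\esum_(z in [set: X * X]) (w z.1 z.2 * (f z.1 - f z.2) ^+ 2)%:E)%E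
    \is a fin_num.
Proof.
move=> w0 wC woo fs.
have w0E x : (0 <= \esum_(y in [set: X]) (w x y)%:E)%E.
  by apply: esum_ge0 => y _; rewrite lee_fin.
pose V x := fine (\esum_(y in [set: X]) (w x y)%:E)%E.
have wV x : (\esum_(y in [set: X]) (w x y)%:E)%E = (V x)%:E.
  by rewrite fineK// ge0_fin_numE.
rewrite ge0_fin_numE; last first.
  by apply: esum_ge0 => z _; rewrite lee_fin mulr_ge0// sqr_ge0.
have E : (\esum_(z in [set: X * X])
      (w z.1 z.2 * (2 * f z.1 ^+ 2 + 2 * f z.2 ^+ 2))%:E)%E =
    (2 * \sum_(x \in [set x | f x != 0]) 2 * f x ^+ 2 * V x)%:E.
  apply: (@esum_vertex_fin w V (fun x => 2 * f x ^+ 2)) => // x.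
    by rewrite mulr_ge0// sqr_ge0.
  by move=> /negP; rewrite negbK => /eqP ->; rewrite expr0n mulr0.
(* The energy is dominated termwise by the finite vertex sum of [2 * f ^+ 2], since the deficit is
   [(f x + f y) ^+ 2]. *)
apply: le_lt_trans (ltry (2 * \sum_(x \in [set x | f x != 0])
  2 * f x ^+ 2 * V x)).
rewrite -E; apply: le_esum => -[x y] _ /=; rewrite lee_fin ler_wpM2l//.
rewrite -subr_ge0 (_ : _ - _ = (f x + f y) ^+ 2) ?sqr_ge0//; ring.
Qed.

(** Harmonicity solved for the neighbour sum; multiplied by [u x], it gives the degree of [x] for
    the weight [b x y * u x * u y]. Summability of [b x y * u y] follows from
    [u y <= |u x - u y| + u x]. *)
Lemma harmonic_neighbours b c m u : graph b -> (forall x, 0 < m x) ->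
  (forall x, 0 < u x) -> harmonic b c m u -> forall x,
  (\esum_(y in [set: X]) (b x y * u y)%:E
   = ((fine (\esum_(y in [set: X]) (b x y)%:E)%E + c x) * u x)%:E)%E.
Proof.
move=> [b0 bC _ boo] m0 u0 [udom uharm] x.
have degE : (\esum_(y in [set: X]) (b x y)%:E)%E =
    (fine (\esum_(y in [set: X]) (b x y)%:E)%E)%:E.
  by rewrite fineK// ge0_fin_numE// esum_ge0// => y _; rewrite lee_fin.
set d := fine _ in degE *.
have bu0 y : 0 <= b x y * u y by rewrite mulr_ge0// ltW.
have bux0 y : 0 <= b x y * u x by rewrite mulr_ge0// ltW.
have buxE : (\esum_(y in [set: X]) (b x y * u x)%:E)%E = (d * u x)%:E.
  under eq_esum do rewrite mulrC EFinM.
  rewrite esumZl ?degE ?(ltW (u0 x))//; last by move=> y; rewrite lee_fin.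
  by rewrite -EFinM mulrC.
have busum : (\esum_(y in [set: X]) (b x y * u y)%:E < +oo)%E.
  apply: (@le_lt_trans _ _ (\esum_(y in [set: X])
      ((b x y * `|u x - u y|)%:E + (b x y * u x)%:E))%E).
    apply: le_esum => y _; rewrite -EFinD lee_fin -mulrDr ler_wpM2l//.
    by rewrite distrC -lerBlDr ler_norm.
  rewrite esumD; last 2 first.
  - by move=> y _; rewrite lee_fin mulr_ge0.
  - by move=> y _; rewrite lee_fin.
  by rewrite buxE lte_add_pinfty ?ltry.
have := uharm x; rewrite /abs_sum.
(* Both families are summable, so the positive and negative parts in [abs_sum] recombine into a
   difference of two sums. *)
have -> : EFin \o (fun y => b x y * (u x - u y)) =
    ((fun y => (b x y * u x)%:E) \- (fun y => (b x y * u y)%:E))%E.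
  by apply/funext => y /=; rewrite mulrBr.
rewrite esumB; last 4 first.
- rewrite /summable; under eq_esum do rewrite gee0_abs ?lee_fin//.
  by rewrite buxE ltry.
- by rewrite /summable; under eq_esum do rewrite gee0_abs ?lee_fin//.
- by move=> y _; rewrite lee_fin.
- by move=> y _; rewrite lee_fin.
rewrite buxE.
have : (\esum_(y in [set: X]) (b x y * u y)%:E)%E \is a fin_num.
  by rewrite ge0_fin_numE// esum_ge0// => y _; rewrite lee_fin.
move=> /fineK <-; set v := fine _.
rewrite -EFinB -EFinM -EFinD => -[E]; congr EFin.
have mN0 : m x != 0 by rewrite gt_eqF.
have : m x * ((m x)^-1 * (d * u x - v) + c x / m x * u x) = 0.
  by rewrite E mulr0.
rewrite (_ : m x * _ = d * u x - v + c x * u x); last by field.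
by move=> H; rewrite mulrDl; lra.
Qed.

(** The cross terms [u x * u y * f x * f y] agree on both sides; what remains are vertex terms.
    Harmonicity evaluates the [b_u]-degree, whose [c] part is exactly the potential term of the
    form. *)
Lemma ground_state b c m u f : graph b -> (forall x, 0 < m x) ->
  (forall x, 0 < u x) -> harmonic b c m u -> finitely_supported f ->
  (quad_form b c (fun x => (u x * f x)%R)
   = (2^-1)%:E * \esum_(z in [set: X * X])
       (b z.1 z.2 * u z.1 * u z.2 * (f z.1 - f z.2) ^+ 2)%:E)%E.
Proof.
move=> gb m0 u0 uharm fs; have [b0 bC _ boo] := gb.
pose d x := fine (\esum_(y in [set: X]) (b x y)%:E)%E.
have nbr x : (\esum_(y in [set: X]) (b x y * u y)%:E)%E =
    ((d x + c x) * u x)%:E by exact: harmonic_neighbours.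
have degE x : (\esum_(y in [set: X]) (b x y)%:E)%E = (d x)%:E.
  by rewrite fineK// ge0_fin_numE// esum_ge0// => y _; rewrite lee_fin.
set D := [set x | f x != 0].
have f0 x : ~ D x -> f x = 0 by move=> /negP; rewrite negbK => /eqP.
have S1 : (\esum_(z in [set: X * X])
      (b z.1 z.2 * ((u z.1 * f z.1) ^+ 2 + (u z.2 * f z.2) ^+ 2))%:E)%E =
    (2 * \sum_(x \in D) (u x * f x) ^+ 2 * d x)%:E.
  apply: (@esum_vertex_fin b d (fun x => (u x * f x) ^+ 2)) => // x.
    exact: sqr_ge0.
  by move=> /f0 ->; rewrite mulr0 expr0n.
have bu0 x y : 0 <= b x y * u x * u y by rewrite !mulr_ge0// ltW.
have S2 : (\esum_(z in [set: X * X])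
      (b z.1 z.2 * u z.1 * u z.2 * (f z.1 ^+ 2 + f z.2 ^+ 2))%:E)%E =
    (2 * \sum_(x \in D) f x ^+ 2 * (u x * ((d x + c x) * u x)))%:E.
  apply: (@esum_vertex_fin (fun x y => b x y * u x * u y)
    (fun x => u x * ((d x + c x) * u x)) (fun x => f x ^+ 2)) => //.
  - by move=> x y; rewrite bC; ring.
  - move=> x; rewrite EFinM -nbr -esumZl ?(ltW (u0 x))//; last first.
      by move=> y; rewrite lee_fin mulr_ge0// ltW.
    by apply: eq_esum => y _; rewrite -EFinM; congr EFin; ring.
  - by move=> x; exact: sqr_ge0.
  - by move=> x /f0 ->; rewrite expr0n.
rewrite /quad_form.
have -> : \sum_(x \in [set: X]) c x * (u x * f x) ^+ 2 =
    \sum_(x \in D) c x * (u x * f x) ^+ 2.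
  by apply/esym/fsbig_widen => // x [_ /f0 /= ->]; rewrite mulr0 expr0n mulr0.
have sumE : \sum_(x \in D) f x ^+ 2 * (u x * ((d x + c x) * u x)) =
    \sum_(x \in D) (u x * f x) ^+ 2 * d x
    + \sum_(x \in D) c x * (u x * f x) ^+ 2.
  rewrite -fsbig_split//; apply: eq_fsbigr => x _ /=; ring.
(* The pointwise identity is summed with the vertex terms added on both sides, so that every family
   stays nonnegative. *)
have : (\esum_(z in [set: X * X])
      (b z.1 z.2 * (u z.1 * f z.1 - u z.2 * f z.2) ^+ 2)%:E +
    (2 * \sum_(x \in D) f x ^+ 2 * (u x * ((d x + c x) * u x)))%:E =
    \esum_(z in [set: X * X])
      (b z.1 z.2 * u z.1 * u z.2 * (f z.1 - f z.2) ^+ 2)%:E +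
    (2 * \sum_(x \in D) (u x * f x) ^+ 2 * d x)%:E)%E.
  rewrite -S2 -S1 -!esumD;
    try by move=> z _; rewrite lee_fin mulr_ge0 ?addr_ge0 ?sqr_ge0.
  by apply: eq_esum => z _; rewrite -!EFinD; congr EFin; ring.
rewrite sumE.
set P := (\esum_(z in _) _)%E; set Q := (\esum_(z in _) _)%E.
(* The added vertex sums are real, so [P] and [Q] are finite or infinite together. *)
case: P => [p| |]; case: Q => [q| |] //; rewrite ?addey ?addeNy//.
  move=> [E]; congr EFin; lra.
- by rewrite gt0_muley// lte_fin invr_gt0.
- by rewrite gt0_muleNy// lte_fin invr_gt0.
Qed.

(** A path from inside [W] to outside has a first edge leaving [W]. *)
Lemma connected_crossing b W : connected_graph b -> W !=set0 ->
  ~` W !=set0 -> exists x y, [/\ W x, ~ W y & 0 < b x y].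
Proof.
move=> [_ bconn] [x Wx] [y Wy]; have [s [xs sy]] := bconn x y.
elim: s x Wx xs sy => [x Wx _ xy|z s IH x Wx /= /andP[bxz zs] sy].
  by case: Wy; rewrite -xy.
by have [Wz|Wz] := pselect (W z); [exact: IH Wz zs sy|exists x, z].
Qed.

(** The squared difference of indicators counts each boundary edge in both orientations, and the
    factor one half undoes this. *)
Lemma dirichlet_indicator w W :
  (forall x y, 0 <= w x y) -> (forall x y, w x y = w y x) ->
  ((2^-1)%:E * (\esum_(z in [set: X * X])
     (w z.1 z.2 * ((z.1 \in W)%:R - (z.2 \in W)%:R) ^+ 2)%:E)
   = \esum_(z in edge_boundary W) (w z.1 z.2)%:E)%E.
Proof.
move=> w0 wC.
pose G x y : R := ((x \in W) && (y \notin W))%:R.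
have -> : (\esum_(z in [set: X * X])
     (w z.1 z.2 * ((z.1 \in W)%:R - (z.2 \in W)%:R) ^+ 2)%:E =
   \esum_(z in [set: X * X])
     (w z.1 z.2 * (G z.1 z.2 + G z.2 z.1))%:E)%E.
  apply: eq_esum => -[x y] _; rewrite /G /=.
  by case: (x \in W); case: (y \in W) => /=; congr EFin; ring.
rewrite esum_symmetrize// muleA -EFinM mulVf ?pnatr_eq0// mul1e.
rewrite [RHS]esum_mkcond; apply: eq_esum => -[x y] _.
have -> : ((x, y) \in edge_boundary W) = (x \in W) && (y \notin W).
  by rewrite /edge_boundary in_setX in_setC.
by rewrite /G /=; case: ifP => _; rewrite ?mulr1 ?mulr0.
Qed.

(* AM-GM applied to [t * rho * |f x + f y| * |f x - f y|], then summed with the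
   intrinsic bound. *)
Lemma coarea_le w rho mu f (t : R) :
  (forall x y, 0 <= w x y) -> (forall x y, w x y = w y x) ->
  (forall x y, 0 <= rho x y) -> (forall x y, rho x y = rho y x) ->
  (forall x, (\esum_(y in [set: X]) (w x y * rho x y ^+ 2)%:E
              <= (mu x)%:E)%E) -> 0 <= t ->
  ((2 * t)%:E * (\esum_(z in [set: X * X])
     (w z.1 z.2 * rho z.1 z.2 * Num.max 0 (f z.1 ^+ 2 - f z.2 ^+ 2))%:E)
   <= (\esum_(z in [set: X * X]) (w z.1 z.2 * (f z.1 - f z.2) ^+ 2)%:E)
      + (t ^+ 2)%:E * (\esum_(x in [set: X]) (mu x * f x ^+ 2)%:E))%E.
Proof.
move=> w0 wC rho0 rhoC intr t0.
have wr0 x y : 0 <= w x y * rho x y by rewrite mulr_ge0.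
have wrr0 x y : 0 <= w x y * rho x y ^+ 2 by rewrite mulr_ge0// sqr_ge0.
pose G x y := Num.max 0 (f x ^+ 2 - f y ^+ 2).
have G0 x y : 0 <= G x y by rewrite le_max lexx.
rewrite mulrC EFinM -muleA -(@esum_symmetrize _ _ (fun x y => w x y * rho x y) G)//;
  last by move=> x y; rewrite wC rhoC.
rewrite -esumZl//; last by move=> z; rewrite lee_fin mulr_ge0// addr_ge0.
apply: (@le_trans _ _ (\esum_(z in [set: X * X])
   ((w z.1 z.2 * (f z.1 - f z.2) ^+ 2)%:E + (t ^+ 2 / 2)%:E *
     (w z.1 z.2 * rho z.1 z.2 ^+ 2 * (f z.1 ^+ 2 + f z.2 ^+ 2))%:E))%E).
  apply: le_esum => -[x y] _ /=; rewrite -!EFinM -EFinD lee_fin.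
  have -> : t * (w x y * rho x y * (G x y + G y x)) =
      w x y * (t * rho x y * `|f x ^+ 2 - f y ^+ 2|).
    have -> : `|f x ^+ 2 - f y ^+ 2| = G x y + G y x; last by ring.
    rewrite /G; have [xy|yx] := leP (f x ^+ 2) (f y ^+ 2).
      rewrite ler0_norm ?subr_le0// max_l ?subr_le0// max_r ?subr_ge0//.
      by rewrite add0r opprB.
    rewrite gtr0_norm ?subr_gt0// max_r ?subr_ge0 ?ltW//.
    by rewrite max_l ?addr0// subr_le0 ltW.
  rewrite [leRHS](_ : _ = w x y * ((f x - f y) ^+ 2 +
    t ^+ 2 / 2 * (rho x y ^+ 2 * (f x ^+ 2 + f y ^+ 2)))); last by field.
  rewrite ler_wpM2l//.
  have -> : f x ^+ 2 - f y ^+ 2 = (f x - f y) * (f x + f y) by ring.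
  rewrite normrM -(real_normK (num_real (f x - f y))).
  have : `|f x + f y| ^+ 2 <= 2 * (f x ^+ 2 + f y ^+ 2).
    rewrite real_normK ?num_real// -subr_ge0.
    rewrite (_ : _ - _ = (f x - f y) ^+ 2) ?sqr_ge0//; ring.
  set r := t * rho x y; set s := `|f x + f y|; set d := `|f x - f y|.
  move=> /(ler_wpM2l (sqr_ge0 r)) H.
  (* This square gives [r * d * s <= d ^+ 2 + r ^+ 2 * s ^+ 2 / 4]. With
     [s ^+ 2 <= 2 * (f x ^+ 2 + f y ^+ 2)] the constant is [t ^+ 2 / 2], which the vertex sum
     doubles to [t ^+ 2]. *)
  have := sqr_ge0 (d - r * s / 2).
  rewrite (_ : t ^+ 2 / 2 * (rho x y ^+ 2 * _) =
    r ^+ 2 * (2 * (f x ^+ 2 + f y ^+ 2)) / 4); last by rewrite /r; field.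
  by rewrite (_ : _ ^+ 2 = d ^+ 2 - r * (d * s) + r ^+ 2 * s ^+ 2 / 4);
    [lra|field].
rewrite esumD; last 2 first.
- by move=> z _; rewrite lee_fin mulr_ge0// sqr_ge0.
- by move=> z _; rewrite -EFinM lee_fin !mulr_ge0 ?sqr_ge0// addr_ge0 ?sqr_ge0.
rewrite leeD2l// esumZl; last 2 first.
- by rewrite mulr_ge0// sqr_ge0.
- by move=> z; rewrite lee_fin mulr_ge0// addr_ge0 ?sqr_ge0.
rewrite (@esum_vertex _ _ (fun x y => w x y * rho x y ^+ 2)
  (fun x => f x ^+ 2))//; last 2 first.
- by move=> x y; rewrite wC rhoC.
- by move=> x; exact: sqr_ge0.
rewrite muleA -EFinM divfK ?pnatr_eq0//.
apply: lee_wpmul2l; first by rewrite lee_fin sqr_ge0.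
apply: le_esum => x _; rewrite (mulrC (mu x)) (EFinM (f x ^+ 2)).
apply: lee_wpmul2l => //.
by rewrite lee_fin sqr_ge0.
Qed.

End GroundState.

(** * The two bounds on the Hardy norm *)

Section HardyCheeger.
Variables (R : realType) (X : countType).
Variables (m : X -> R) (b : X -> X -> R) (c u g : X -> R).
Hypotheses (m0 : forall x, 0 < m x) (bconn : connected_graph b).
Hypotheses (u0 : forall x, 0 < u x) (uharm : harmonic b c m u).
Hypothesis g0 : forall x, 0 < g x.

Let gb : graph b. Proof. by case: bconn. Qed.
Let bu x y := b x y * u x * u y.
Let mu x := m x * `|g x| * u x ^+ 2.

Let bu0 x y : 0 <= bu x y.
Proof. by rewrite !mulr_ge0 ?(ltW (u0 _))// (graph_ge0 gb). Qed.

Let buC x y : bu x y = bu y x.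
Proof. by rewrite /bu (graph_sym gb); ring. Qed.

Let mu0 x : 0 < mu x.
Proof. by rewrite !mulr_gt0 ?exprn_gt0 ?normr_gt0 ?gt_eqF. Qed.

Let bu_summable x : (\esum_(y in [set: X]) (bu x y)%:E < +oo)%E.
Proof.
have -> : (\esum_(y in [set: X]) (bu x y)%:E =
    (u x)%:E * \esum_(y in [set: X]) (b x y * u y)%:E)%E.
  rewrite -esumZl ?(ltW (u0 x))//.
    by apply: eq_esum => y _; rewrite -EFinM /bu; congr EFin; ring.
  by move=> y; rewrite lee_fin mulr_ge0 ?(graph_ge0 gb)// ltW.
by rewrite (harmonic_neighbours gb m0 u0 uharm) -EFinM ltry.
Qed.

Lemma inv_cheeger_le_hardy_norm : infinite_set [set: X] ->
  (1 / cheeger bu mu <= hardy_norm b c m g)%E.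
Proof.
move=> Xinf.
have key W : W !=set0 -> finite_set W ->
    exists r s : R, [/\ 0 < r, 0 < s,
      (\esum_(x in W) (mu x)%:E = r%:E)%E,
      (\esum_(z in edge_boundary W) (bu z.1 z.2)%:E = s%:E)%E
      & ((r / s)%:E <= hardy_norm b c m g)%E].
  move=> W0 fW; pose f x : R := (x \in W)%:R.
  have fs : finitely_supported f.
    apply: sub_finite_set fW => x /=; rewrite /f; case: (boolP (x \in W)).
      by rewrite inE.
    by rewrite eqxx.
  have [r r0 rE] := measure_finite_gt0 mu0 W0 fW.
  have QE := ground_state gb m0 u0 uharm fs.
  rewrite (dirichlet_indicator W bu0 buC) in QE.
  (* As [X] is infinite, the finite set [W] has a nonempty complement; connectedness then makes its
     boundary weight positive. *)
  have [x [y [Wx Wy bxy]]] : exists x y, [/\ W x, ~ W y & 0 < b x y].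
    apply: connected_crossing bconn W0 _; apply: contrapT => WC.
    apply: Xinf; apply: sub_finite_set fW => z _; apply: contrapT => Wz.
    by apply: WC; exists z.
  have Q0 : (0 < \esum_(z in edge_boundary W) (bu z.1 z.2)%:E)%E.
    apply: (@lt_le_trans _ _ (bu x y)%:E); first by rewrite lte_fin !mulr_gt0.
    apply: esum_ge; exists [set (x, y)]; last by rewrite fsbig_set1.
    by split; [exact: finite_set1|move=> _ -> /=].
  have : (\esum_(z in edge_boundary W) (bu z.1 z.2)%:E)%E \is a fin_num.
    rewrite -dirichlet_indicator// fin_numM//.
    exact: (@dirichlet_fin_num _ _ bu f).
  move: Q0 QE; case: (\esum_(z in _) _)%E => // s; rewrite lte_fin => s0 QE _.
  exists r, s; split => //.
  apply: ereal_sup_ubound; exists (fun x => u x * f x).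
    split; last by rewrite QE => -[/eqP]; rewrite gt_eqF.
    apply: sub_finite_set fs => z /=; apply: contra_neq => ->.
    by rewrite mulr0.
  rewrite QE inver gt_eqF// EFinM -rE; congr (_ * _)%E.
  rewrite [RHS]esum_mkcond; apply: eq_esum => z _; rewrite /f.
  by case: ifP => _; rewrite /mu ?mulr1 ?mulr0; congr EFin; ring.
have [x0 _] : [set: X] !=set0 by exact: infinite_setN0.
have N0 : (0 <= hardy_norm b c m g)%E.
  have [|r [s [r0 s0 _ _]]] := key [set x0] _ (finite_set1 x0).
    by exists x0.
  by apply: le_trans; rewrite lee_fin divr_ge0// ltW.
(* Inversion reverses the order on nonnegative extended reals, so the claim becomes a lower bound on
   an infimum, checked for each [W]. *)
rewrite div1e -[leRHS]inveK lee_pV2 ?inE ?inve_ge0 ?cheeger_ge0//.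
apply: le_ereal_inf_tmp => _ [W [W0 fW] <-].
have [r [s [r0 s0 rE sE rs]]] := key W W0 fW; rewrite rE sE.
have -> : (s%:E / r%:E)%E = ((r / s)%:E)^-1%E.
  rewrite !inver !gt_eqF ?divr_gt0// -EFinM; congr EFin; field.
  by rewrite !gt_eqF.
by rewrite lee_pV2 ?inE ?lee_fin// divr_ge0// ltW.
Qed.

Lemma hardy_norm_le_cheeger rho : pseudo_metric rho ->
  (forall x, (((m x * `|g x|)^-1)%:E *
     (\esum_(y in [set: X]) (u y / u x * b x y * rho x y ^+ 2)%:E) <= 1)%E) ->
  (hardy_norm b c m g
   <= 2%:E / cheeger (fun x y => (bu x y * rho x y)%R) mu ^+ 2)%E.
Proof.
move=> [rho0 _ rhoC _] intr.
have b0 := graph_ge0 gb.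
have burho0 x y : 0 <= bu x y * rho x y by rewrite mulr_ge0.
have intr' x : (\esum_(y in [set: X]) (bu x y * rho x y ^+ 2)%:E
    <= (mu x)%:E)%E.
  have mg0 : 0 < m x * `|g x| by rewrite mulr_gt0// normr_gt0 gt_eqF.
  have -> : (\esum_(y in [set: X]) (bu x y * rho x y ^+ 2)%:E =
      (u x ^+ 2)%:E *
      \esum_(y in [set: X]) (u y / u x * b x y * rho x y ^+ 2)%:E)%E.
    rewrite -esumZl ?sqr_ge0//.
      apply: eq_esum => y _; rewrite -EFinM /bu; congr EFin; field.
      by rewrite gt_eqF.
    move=> y; rewrite lee_fin !mulr_ge0 ?sqr_ge0 ?invr_ge0//;
      exact: ltW.
  rewrite /mu (mulrC (m x * _)) (EFinM (u x ^+ 2)) lee_pmul2l ?lte_fin ?exprn_gt0//.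
  by have := intr x; rewrite lee_pdivrMl// mule1.
set h := cheeger _ _; have h0 : (0 <= h)%E by exact: cheeger_ge0.
apply: ge_ereal_sup => _ [phi [phis phiQ] <-].
pose f x := phi x / u x.
have phiE : phi = (fun x => u x * f x).
  by apply/funext => x; rewrite /f mulrC divfK// gt_eqF.
have fs : finitely_supported f.
  apply: sub_finite_set phis => x /=; apply: contra_neq; rewrite /f => ->.
  by rewrite mul0r.
have QE := ground_state gb m0 u0 uharm fs; rewrite -phiE in QE.
rewrite {}QE in phiQ *.
have ME : (\esum_(x in [set: X]) (m x * `|g x| * phi x ^+ 2)%:E =
    \esum_(x in [set: X]) (mu x * f x ^+ 2)%:E)%E.
  by apply: eq_esum => x _; rewrite phiE /mu; congr EFin; ring.
rewrite {}ME.
have f20 x : 0 <= f x ^+ 2 by exact: sqr_ge0.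
have f2s : finitely_supported (fun x => f x ^+ 2).
  by apply: sub_finite_set fs => x /=; rewrite sqrf_eq0.
have coarea := cheeger_coarea burho0 mu0 f20 f2s.
have coarea_ub := fun t => coarea_le f bu0 buC rho0 rhoC intr' (t := t).
have Cfin := dirichlet_fin_num bu0 buC bu_summable fs.
have C0 : (0 <= \esum_(z in [set: X * X])
    (bu z.1 z.2 * (f z.1 - f z.2) ^+ 2)%:E)%E.
  by apply: esum_ge0 => z _; rewrite lee_fin mulr_ge0// sqr_ge0.
have S0 : (0 <= \esum_(z in [set: X * X])
    (bu z.1 z.2 * rho z.1 z.2 * Num.max 0 (f z.1 ^+ 2 - f z.2 ^+ 2))%:E)%E.
  by apply: esum_ge0 => z _; rewrite lee_fin mulr_ge0// le_max lexx.
have M0 : (0 <= \esum_(x in [set: X]) (mu x * f x ^+ 2)%:E)%E.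
  by apply: esum_ge0 => x _; rewrite lee_fin mulr_ge0// ltW.
have Mfin : (\esum_(x in [set: X]) (mu x * f x ^+ 2)%:E)%E \is a fin_num.
  rewrite (@esum_finite_support _ _ _ _ fs)// => x.
    by rewrite mulr_ge0// ltW.
  by move=> /negP; rewrite negbK => /eqP ->; rewrite expr0n mulr0.
move: phiQ coarea coarea_ub Cfin C0 S0 M0 Mfin.
rewrite -/h.
set C := (\esum_(z in _) (bu z.1 z.2 * (f z.1 - f z.2) ^+ 2)%:E)%E.
rewrite -/C.
set M := (\esum_(x in _) _)%E; set S := (\esum_(z in _) _)%E.
case: C => // C; case: M => // M.
move=> CN0 hM ub _; rewrite !lee_fin => C0 S0 M0 _.
(* The supremum runs over test functions with nonzero form, which here equals [C / 2]. *)
have {}C0 : 0 < C.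
  rewrite lt_neqAle C0 andbT; apply/eqP => C0'; apply: CN0.
  by rewrite -C0' mule0.
(* The bound at [t = 1] reads [2 * S <= C + M], with a finite right-hand side. *)
have Sfin : S \is a fin_num.
  rewrite ge0_fin_numE//; have := ub 1 ler01.
  rewrite -EFinM -EFinD mulr1; case: (S) => [r| |] //; first by rewrite ltry.
  by rewrite gt0_muley ?lte_fin.
case: S Sfin hM ub S0 => // S _ hM ub; rewrite lee_fin => S0.
rewrite -EFinM inver gt_eqF ?mulr_gt0 ?invr_gt0//.
have RHS0 : (0 <= 2%:E / h ^+ 2)%E.
  by rewrite mule_ge0 ?inve_ge0 ?lee_fin// mule_ge0.
have [M0'|MN0] := eqVneq M 0; first by rewrite M0' mul0e.
have {}M0 : 0 < M by rewrite lt_neqAle eq_sym MN0.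
(* An infinite [h] would contradict [h * M <= S], as [M] is positive and [S] finite. For [h = 0] the
   right-hand side is infinite by convention. *)
case: h h0 hM {RHS0} => [h| |] //; last first.
  by rewrite gt0_mulye ?lte_fin.
rewrite lee_fin -EFinM => h0; rewrite lee_fin => hM.
have [->|hN0] := eqVneq h 0.
  by rewrite expe2 mule0 inve0 gt0_muley ?lte_fin// leey.
have {}h0 : 0 < h by rewrite lt_neqAle eq_sym hN0.
(* The choice [t = h] gives [2 * h * S <= C + h ^+ 2 * M]; inserting [h * M <= S] leaves
   [h ^+ 2 * M <= C], where [C] is twice the form. *)
have := ub h (ltW h0); rewrite -!EFinM -EFinD lee_fin => ubh.
rewrite expe2 -EFinM inver mulf_eq0 (negbTE hN0) -EFinM lee_fin.
rewrite ler_pdivrMr ?mulr_gt0 ?invr_gt0//.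
rewrite (_ : 2 / _ * _ = C / (h * h)); last by field.
rewrite ler_pdivlMr ?mulr_gt0//.
have : h * (h * M) <= h * S by rewrite ler_wpM2l// ltW.
lra.
Qed.

End HardyCheeger.

Unset Implicit Arguments.

Theorem theorem6p3 (R : realType) (X : countType)
  (m : X -> R) (b : X -> X -> R) (c : X -> R) (u g : X -> R)
  (rho : X -> X -> R) :
  infinite_set [set: X] ->
  (forall x, 0 < m x) ->
  connected_graph b ->
  (forall phi : X -> R, finitely_supported phi -> (0 <= quad_form b c phi)%E) ->
  (forall x, 0 < u x) ->
  harmonic b c m u ->
  (forall x, 0 < g x) ->
  pseudo_metric rho ->
  (forall x, (((m x * `|g x|)^-1)%:E *
     (\esum_(y in [set: X]) (u y / u x * b x y * rho x y ^+ 2)%:E) <= 1)%E) ->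
  let b_u := fun x y => b x y * u x * u y in
  let mu := fun x => m x * `|g x| * u x ^+ 2 in
  (1 / cheeger b_u mu <= hardy_norm b c m g)%E /\
  (hardy_norm b c m g <= 2%:E / cheeger (fun x y => (b_u x y * rho x y)%R) mu ^+ 2)%E.
Proof.
move=> Xinf m0 bconn _ u0 uharm g0 rhometric intr b_u mu; split.
  exact: inv_cheeger_le_hardy_norm.
exact: hardy_norm_le_cheeger.
Qed.
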